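(* Let $n$ be a positive integer, $K$ a field whose characteristic does not divide $n$, $\zeta_n$ a primitive $n$-th root of unity in a fixed algebraic closure $\overline K$, and $M=K(\zeta_n)$. Let $L=K(\alpha)\subseteq\overline K$ be a finite extension of $K$. The following are equivalent: (1) $L\cap M=K$, $\alpha^n\in K$, and $n$ is the smallest positive integer $m$ with $\alpha^m\in K$. (2) $L/K$ is an almost cyclic extension of degree $n$ with Galois complement $M$, and $\alpha$ is an $H$-eigenvector, where $H$ is the almost classically Galois structure on $L/K$ corresponding to $M$.
   Context: Hopf-Galois structures: for a finite extension $L/K$, a pair $(H,\cdot)$ with $H$ a finite-dimensional cocommutative $K$-Hopf algebra and $\cdot$ a $K$-linear action making $L$ an $H$-module algebra such that $L\otimes_KH\to\mathrm{End}_K(L)$, $x\otimes h\mapsto(y\mapsto x(h\cdot y))$, is bijective. Greither–Pareigis: for finite separable $L/K$ with normal closure $\widetilde L$, $G=\mathrm{Gal}(\widetilde L/K)$, $G'=\mathrm{Gal}(\widetilde L/L)$, $X=G/G'$, $\lambda(g)(hG')=ghG'$; Hopf-Galois structures correspond to regular subgroups $N\le\mathrm{Perm}(X)$ normalized by $\lambda(G)$, the structure being $H=\widetilde L[N]^G$ ($G$ acting on $\widetilde L$ and on $N$ by conjugation by $\lambda(g)$) with $(\sum_\eta h_\eta\eta)\cdot\alpha=\sum_\eta h_\eta g_\eta(\alpha)$ where $\eta^{-1}(1_GG')=g_\eta G'$. $L/K$ is almost classically Galois if $G'$ has a normal complement $J$ in $G$; $M=\widetilde L^J$ is a Galois complement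 (equivalently $M/K$ Galois, $L,M$ $K$-linearly disjoint, $LM=\widetilde L$). The almost classically Galois structure corresponding to $M$ is the one given by $N$ = centralizer of $\lambda(J)$ in $\mathrm{Perm}(X)$. $L/K$ is almost cyclic if $J$ is cyclic. A nonzero $\alpha\in L$ is an $H$-eigenvector if $h\cdot\alpha\in K\alpha$ for all $h\in H$.
   Formalization: The case n = 1, α = 0 is excluded: there (1) holds (L = M = K and 0 lies in K) but (2) fails, because an H-eigenvector is nonzero by definition. *)

(* Defs.v *)
From HB Require Import structures.
From mathcomp Require Import all_boot all_order all_algebra all_fingroup.
From mathcomp Require Import all_solvable all_field.

Set Implicit Arguments.
Unset Strict Implicit.
Unset Printing Implicit Defensive.

Import GRing.Theory.
Local Open Scope ring_scope.

(* Conventions: Omega is a finite normal extension of K and plays the role of *)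
(* the algebraic closure; K itself is the subfield 1.  The group law of       *)
(* gal_of E, like the one of {perm T}, composes from left to right:           *)
(* (x * y) a = y (x a).  Hence the left coset g G' of the classical notation  *)
(* (all g o h with h in G') is the right coset G' :* g here, left             *)
(* multiplication by g in the classical notation is right multiplication by g *)
(* here, and the classical conjugate s t s^-1 is t ^ s.                       *)

Section HopfGalois.

Variables (K : fieldType) (Omega : splittingFieldType K).
Implicit Types (L M : {subfield Omega}) (alpha beta : Omega).

Definition conjugates L : seq Omega :=
  [seq (x : gal_of {:Omega}%AS) v | x <- enum 'Gal({:Omega} / 1)%g,
                                   v <- vbasis L].

Definition normal_closure L : {subfield Omega} := <<1 & conjugates L>>%AS.

Lemma sub_normal_closure L : (L <= normal_closure L)%VS.
Proof.
rewrite -(span_basis (vbasisP L)); apply/span_subvP => v Bv.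
apply: seqv_sub_adjoin; apply/allpairsP; exists (1%g, v).
by split; rewrite ?mem_enum ?group1 //= gal_id.
Qed.

Lemma normal_closure_normal L : normalField 1 (normal_closure L).
Proof.
apply/forall_inP => f kf.
have [x Gx Dx]: exists2 x : gal_of {:Omega}%AS,
    x \in 'Gal({:Omega} / 1)%g & f =1 x.
  have := kf; rewrite inE => /kAut_to_gal[x Gx Dx].
  by exists x => // a; apply: Dx; rewrite memvf.
rewrite -dimv_leqif_eq ?limg_dim_eq ?(eqP (AEnd_lker0 f)) ?capv0 //.
rewrite aimg_adjoin_seq aimg1; apply/Fadjoin_seqP; split; first exact: sub1v.
move=> _ /mapP[_ /allpairsP[[y v] /= [Gy Bv ->]] ->].
rewrite mem_enum in Gy.
apply: seqv_sub_adjoin; apply/allpairsP; exists ((y * x)%g, v) => /=.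
by rewrite mem_enum groupM // galM ?memvf ?Dx.
Qed.

Lemma normal_closure_min L (E : {subfield Omega}) :
  (L <= E)%VS -> normalField 1 E -> (normal_closure L <= E)%VS.
Proof.
move=> sLE nE; apply/Fadjoin_seqP; split; first exact: sub1v.
move=> _ /allpairsP[[x v] /= [Gx Bv ->]].
have Ev: v \in E by apply: (subvP sLE); apply: vbasis_mem.
rewrite mem_enum gal_kAut ?sub1v // in Gx.
have xE: (x @: E == E)%VS by apply: (forall_inP nE); rewrite inE.
by rewrite -(eqP xE) memv_img.
Qed.

(* G, G' and X = G/G'. *)
Definition galG L : {group gal_of (normal_closure L)} :=
  'Gal(normal_closure L / 1)%G.

Definition galG' L : {group gal_of (normal_closure L)} :=
  'Gal(normal_closure L / L)%G.

Definition coset_space L : {set {set gal_of (normal_closure L)}} :=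
  rcosets (galG' L) (galG L).

(* Perm(X) is rendered as perm.Sym X: permutations of the type of all sets of *)
(* automorphisms that fix every set outside X.                                *)
Definition lambda L (g : gal_of (normal_closure L)) :
    {perm {set gal_of (normal_closure L)}} :=
  restr_perm (coset_space L) (actperm 'Rs%act g).

Lemma lambda_Sym L g : @lambda L g \in perm.Sym (coset_space L).
Proof. by rewrite inE restr_perm_on. Qed.

Lemma lambdaE L (g : gal_of (normal_closure L)) A :
  g \in galG L -> A \in coset_space L -> lambda g A = (A :* g)%g.
Proof.
move=> Gg XA; rewrite /lambda restr_permE ?actpermE //= ?rcosetE //.
apply/astabsP => B; rewrite /= apermE actpermE /= rcosetE.
apply/rcosetsP/rcosetsP => -[x Gx].
  move/(congr1 (fun C => C :* g^-1)%g).
  rewrite -!rcosetM mulgV rcoset1 => ->.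
  by exists (x * g^-1)%g => //; rewrite groupM ?groupV.
by move=> ->; exists (x * g)%g; rewrite ?groupM ?rcosetM.
Qed.

(* An element \sum_eta h_eta eta of the group algebra of N over the normal    *)
(* closure of L is represented by its family of coefficients.                 *)
Definition group_algebra L (N : {set {perm {set gal_of (normal_closure L)}}})
    (h : {ffun {perm {set gal_of (normal_closure L)}} -> Omega}) : Prop :=
  (forall eta, h eta \in normal_closure L)
  /\ (forall eta, eta \notin N -> h eta = 0).

(* g . (\sum_eta h_eta eta) = \sum_eta g(h_eta) (lambda(g) eta lambda(g)^-1)  *)
Definition galois_act L (g : gal_of (normal_closure L))
    (h : {ffun {perm {set gal_of (normal_closure L)}} -> Omega}) :
    {ffun {perm {set gal_of (normal_closure L)}} -> Omega} :=
  [ffun eta => g (h (eta ^ (lambda g)^-1)%g)].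

Definition hopf_algebra L (N : {set {perm {set gal_of (normal_closure L)}}})
    (h : {ffun {perm {set gal_of (normal_closure L)}} -> Omega}) : Prop :=
  group_algebra N h /\ forall g, g \in galG L -> galois_act g h = h.

(* repr picks a g_eta in the coset eta^-1(1 G'); for beta in L the value does *)
(* not depend on this choice.                                                 *)
Definition hopf_action L (N : {set {perm {set gal_of (normal_closure L)}}})
    (h : {ffun {perm {set gal_of (normal_closure L)}} -> Omega}) beta : Omega :=
  \sum_(eta in N) h eta * repr ((eta^-1)%g (galG' L : {set _})) beta.

Definition eigenvector L (N : {set {perm {set gal_of (normal_closure L)}}})
    alpha : Prop :=
  [/\ alpha \in L, alpha != 0
    & forall h, hopf_algebra N h ->
        exists c : K, hopf_action N h alpha = c *: alpha].

(* L/K is almost classically Galois, J is a normal complement of G' in G and  *)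
(* M is the corresponding Galois complement.                                  *)
Definition galois_complement L M
    (J : {group gal_of (normal_closure L)}) : Prop :=
  [/\ separable 1 L, (J ><| galG' L)%g = galG L & fixedField J = M].

Definition acg_subgroup L (J : {group gal_of (normal_closure L)}) :
    {set {perm {set gal_of (normal_closure L)}}} :=
  'C_(perm.Sym (coset_space L))(@lambda L @: J)%g.

End HopfGalois.

Arguments galois_complement {K Omega} L M J.
Arguments eigenvector {K Omega} L N alpha.
Arguments acg_subgroup {K Omega} L J.

(* Main.v *)
Require Import Defs.
From HB Require Import structures.
From mathcomp Require Import all_boot all_order all_algebra all_fingroup.
From mathcomp Require Import all_solvable all_field.

Import GRing.Theory.
Local Open Scope ring_scope.

(** Write u(j) = j(alpha) / alpha for j in J.  If alpha is an eigenvector,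
    applying it to the traces of the elements m lambda(j) of the group algebra
    and using the independence of the automorphisms shows that J fixes u(j).
    Hence u is a homomorphism from J to the n-th roots of unity, injective
    because alpha generates L; this yields (1).  Conversely, under (1) a
    proper factor of X^n - alpha^n over M would have a constant coefficient
    alpha^d zeta^k, putting alpha^d in the intersection of L and M, which is
    K; so this polynomial is irreducible over M, J = Gal(M(alpha)/M) has order
    n, u embeds J in the roots of unity, and the equality u(g j g^-1) = g(u(j))
    makes the eigenvalues of H rational.  As J is abelian and lambda(J) is
    transitive, the centralizer N of lambda(J) is lambda(J) itself. *)

(** * Galois theory of the normal closure and the regular action of J on the cosets *)

Section AlmostClassicalStructure.

Set Implicit Arguments.
Unset Strict Implicit.

Variables (K : fieldType) (Omega : splittingFieldType K).
Variable L : {subfield Omega}.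
Implicit Types g x j : gal_of (normal_closure L).

Lemma normal_closure_galois : separable 1 L -> galois 1 (normal_closure L).
Proof.
move=> /separableP sepL; apply/and3P; split.
- exact: sub1v.
- apply/separable_Fadjoin_seq/allP=> _ /allpairsP[[x v] /= [Gx Bv ->]].
  have sepv := sepL v (vbasis_mem Bv).
  apply/separable_elementP; exists (minPoly 1 v); split=> //.
    exact: minPolyOver.
  rewrite mem_enum in Gx.
  (* [x] fixes the coefficients, so the conjugate [x v] is again a root of the separable polynomial
     [minPoly 1 v]. *)
  have fixp : map_poly x (minPoly 1 v) = minPoly 1 v.
    by apply: (fixedPoly_gal _ Gx); rewrite ?sub1v ?minPolyOver.
  by rewrite -fixp fmorph_root root_minPoly.
- exact: normal_closure_normal.
Qed.

Lemma coset_space_rcoset A g :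
  A \in coset_space L -> g \in galG L -> (A :* g)%g \in coset_space L.
Proof.
move=> /rcosetsP[x Gx ->] Gg; apply/rcosetsP; exists (x * g)%g.
  exact: groupM.
by rewrite rcosetM.
Qed.

Lemma lambda_out A g : A \notin coset_space L -> lambda g A = A.
Proof.
by move=> XA; have := lambda_Sym g; rewrite inE => /out_perm; apply.
Qed.

Lemma lambdaM :
  {in galG L &, {morph @lambda _ _ L : x y / (x * y)%g >-> (x * y)%g}}.
Proof.
move=> x y Gx Gy; apply/permP=> A; rewrite permM.
have [XA|XA] := boolP (A \in coset_space L); last by rewrite !lambda_out.
rewrite (@lambdaE _ _ _ x) // !lambdaE ?groupM ?coset_space_rcoset //.
by rewrite rcosetM.
Qed.

Canonical lambda_morphism := Morphism lambdaM.

Lemma coset_space1 : (galG' L : {set _}) \in coset_space L.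
Proof. by apply/rcosetsP; exists 1%g; rewrite ?group1 ?rcoset1. Qed.

Lemma lambda_coset1 g : g \in galG L -> lambda g (galG' L) = (galG' L :* g)%g.
Proof. by move=> Gg; rewrite lambdaE ?coset_space1. Qed.

(** Every element of the coset has the form [t * g^-1] with [t] in G'; [t] acts first and fixes
    [beta]. *)
Lemma repr_lambda_coset1 g beta : g \in galG L -> beta \in L ->
  repr ((lambda g)^-1%g (galG' L : {set _})) beta = g^-1%g beta.
Proof.
move=> Gg Lb; rewrite -(morphV lambda_morphism) //= lambda_coset1 ?groupV //.
have /rcosetP[t G't ->] := mem_repr_rcoset (galG' L) (g^-1%g).
have sLE := sub_normal_closure L.
by rewrite galM ?(subvP sLE) // (fixed_gal sLE G't).
Qed.

(** As G = G' J, [lambda] of J moves the base coset to every other one, and a permutation commuting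
    with a transitive group is determined by the image of one point. *)
Lemma eq_on_regular_orbit (J : {group gal_of (normal_closure L)}) eta theta :
    J \subset galG L -> {subset galG L <= (galG' L * J)%g} ->
    eta \in acg_subgroup L J -> theta \in acg_subgroup L J ->
  eta (galG' L : {set _}) = theta (galG' L : {set _}) -> eta = theta.
Proof.
move=> sJG sGJ /setIP[Seta /centP Ceta] /setIP[Stheta /centP Ctheta] eq1.
apply/permP=> A; have [XA|XA] := boolP (A \in coset_space L); last first.
  by move: Seta Stheta; rewrite !inE => /out_perm-> // /out_perm->.
have /rcosetsP[g Gg ->] := XA; have /mulsgP[t j G't Jj ->] := sGJ g Gg.
rewrite rcosetM (rcoset_id G't) -lambda_coset1 ?(subsetP sJG) //.
have JlJ: lambda j \in (@lambda _ _ L @: J)%g by apply: imset_f.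
by rewrite -!permM -(Ceta _ JlJ) -(Ctheta _ JlJ) !permM eq1.
Qed.

Lemma acg_subgroup_abelian (J : {group gal_of (normal_closure L)}) :
    abelian J -> (J ><| galG' L)%g = galG L ->
  acg_subgroup L J = @lambda _ _ L @: J.
Proof.
move=> abJ sdJ; have [/andP[sJG _] _ defG nJG' _] := sdprod_context sdJ.
have sGJ: {subset galG L <= (galG' L * J)%g}.
  by move=> g Gg; rewrite (normC nJG') defG.
have sJN: {subset @lambda _ _ L @: J <= acg_subgroup L J}.
  move=> _ /imsetP[j Jj ->]; rewrite inE lambda_Sym; apply/centP.
  move=> _ /imsetP[k Jk ->]; rewrite /commute -!lambdaM ?(subsetP sJG) //.
  by rewrite (centsP abJ).
apply/setP=> eta; apply/idP/idP; last exact: sJN.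
move=> Neta; have := Neta; rewrite inE => /andP[Seta _].
have: eta (galG' L : {set _}) \in coset_space L.
  by rewrite inE in Seta; rewrite (perm_closed _ Seta) coset_space1.
case/rcosetsP=> g Gg; have /mulsgP[t j G't Jj ->] := sGJ g Gg.
rewrite rcosetM (rcoset_id G't) -lambda_coset1 ?(subsetP sJG) // => eq1.
have JlJ: lambda j \in (@lambda _ _ L @: J)%g by apply: imset_f.
by rewrite (eq_on_regular_orbit sJG sGJ Neta (sJN _ JlJ) eq1).
Qed.

(** The stabilizer of the base coset is G', which meets J trivially. *)
Lemma lambda_inj (J : {group gal_of (normal_closure L)}) :
    (J ><| galG' L)%g = galG L ->
  {in J &, injective (@lambda _ _ L)}.
Proof.
move=> sdJ; have [/andP[sJG _] _ _ _ tiJ] := sdprod_context sdJ.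
move=> x y Jx Jy /(congr1 (fun s : {perm _} => s (galG' L : {set _}))).
rewrite !lambda_coset1 ?(subsetP sJG) // => eqxy.
have: x \in (galG' L :* y)%g by rewrite -eqxy rcoset_refl.
rewrite mem_rcoset => G'xy; apply/eqP; rewrite eq_mulgV1 -in_set1.
have <- : (J :&: galG' L)%g = [set 1%g] by rewrite tiJ.
by rewrite inE G'xy andbT groupM ?groupV.
Qed.

(** * The Hopf action written as a sum over J, and its eigenvectors *)

Lemma hopf_actionE (J : {group gal_of (normal_closure L)}) h beta :
    abelian J -> (J ><| galG' L)%g = galG L -> beta \in L ->
  hopf_action (acg_subgroup L J) h beta
    = \sum_(j in J) h (lambda j) * j^-1%g beta.
Proof.
move=> abJ sdJ Lb; have [/andP[sJG _] _ _ _ _] := sdprod_context sdJ.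
rewrite /hopf_action acg_subgroup_abelian // big_imset /=; last first.
  exact: lambda_inj sdJ.
by apply: eq_bigr => j Jj; rewrite repr_lambda_coset1 ?(subsetP sJG).
Qed.

(* The trace from the group algebra to the Hopf algebra of the element        *)
(* m lambda(j).                                                               *)
Definition orbit_sum (m : Omega) j :
    {ffun {perm {set gal_of (normal_closure L)}} -> Omega} :=
  [ffun eta => \sum_(g in galG L | lambda (j ^ g)%g == eta) (g : gal_of _) m].

(** Normality of J keeps the support in [lambda] of J; acting by [g] only translates the summation
    index to [x * g]. *)
Lemma hopf_algebra_orbit_sum (J : {group gal_of (normal_closure L)}) m j :
    abelian J -> (J ><| galG' L)%g = galG L -> m \in normal_closure L ->
    j \in J ->
  hopf_algebra (acg_subgroup L J) (orbit_sum m j).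
Proof.
move=> abJ sdJ Em Jj; have [/andP[sJG nJG] _ _ _ _] := sdprod_context sdJ.
have Gj := subsetP sJG _ Jj.
split; first split=> eta.
- by rewrite ffunE rpred_sum // => g _; rewrite memv_gal.
- rewrite ffunE acg_subgroup_abelian // => N'eta; apply: big1 => g.
  case/andP=> Gg /eqP eq_eta; case/negP: N'eta; rewrite -eq_eta imset_f //.
  by rewrite memJ_norm ?(subsetP nJG).
move=> g Gg; apply/ffunP=> eta; rewrite !ffunE rmorph_sum /=.
rewrite [RHS](reindex_inj (mulIg g)) /=; apply: eq_big => [x | x _]; last first.
  by rewrite galM.
rewrite groupMr //; apply: andb_id2l => Gx.
have ->: (lambda (j ^ (x * g)) = lambda (j ^ x) ^ lambda g)%g.
  by rewrite conjgM (morphJ lambda_morphism) //= groupJ.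
by apply/eqP/eqP=> [->|<-]; rewrite ?conjgK ?conjgKV.
Qed.

Lemma hopf_action_orbit_sum (J : {group gal_of (normal_closure L)}) m j beta :
    abelian J -> (J ><| galG' L)%g = galG L -> j \in J -> beta \in L ->
  hopf_action (acg_subgroup L J) (orbit_sum m j) beta
    = \sum_(g in galG L) (g : gal_of _) m * (j ^ g)^-1%g beta.
Proof.
move=> abJ sdJ Jj Lb; have [/andP[sJG nJG] _ _ _ _] := sdprod_context sdJ.
have Jjg g : g \in galG L -> (j ^ g)%g \in J.
  by move=> Gg; rewrite memJ_norm ?(subsetP nJG).
rewrite (partition_big (fun g => lambda (j ^ g)%g) [in acg_subgroup L J]) /=.
  apply: eq_bigr => eta _; rewrite ffunE mulr_suml; apply: eq_bigr => g.
  case/andP=> Gg /eqP <-; rewrite repr_lambda_coset1 //.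
  by rewrite (subsetP sJG) ?Jjg.
by move=> g Gg; rewrite acg_subgroup_abelian // imset_f ?Jjg.
Qed.

Lemma eigenvector_ratio_fixed (J : {group gal_of (normal_closure L)}) alpha :
    abelian J -> (J ><| galG' L)%g = galG L ->
    eigenvector L (acg_subgroup L J) alpha ->
  forall j s, j \in J -> s \in J -> s (j alpha / alpha) = j alpha / alpha.
Proof.
move=> abJ sdJ [La nza eig] j s Jj Js.
have [/andP[sJG nJG] _ _ _ _] := sdprod_context sdJ.
have Ea := subvP (sub_normal_closure L) _ La.
have Gs := subsetP sJG _ Js.
have nzsa : s alpha != 0 by rewrite fmorph_eq0.
(* [F g] is the coefficient of [g m] in a relation between the trace identity for [m] and its image
   under [s]. Independence of automorphisms kills every coefficient, and [F 1 = 0] is the claim up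
   to commuting [j] and [s]. *)
pose F g := (j ^ g)%g (s alpha) * alpha - (j ^ g)%g alpha * s alpha.
have: F 1%g = 0.
  apply: (@gal_independent _ _ _ [in galG L] F) => [m Em|]; last exact: group1.
  (* The Hopf action applies inverses, so starting from [j^-1] makes [j] itself appear. *)
  have Jj1 : (j^-1)%g \in J by rewrite groupV.
  have [c] := eig _ (hopf_algebra_orbit_sum abJ sdJ Em Jj1).
  rewrite hopf_action_orbit_sum //.
  under eq_bigr do rewrite conjVg invgK.
  move=> trE; have := congr1 s trE; rewrite linearZ /= rmorph_sum /=.
  (* This shift turns [s (g m)] back into [g m], so that both identities have the same characters;
     [s] fixes the eigenvalue because it lies in K. *)
  rewrite (reindex_inj (mulIg s^-1%g)) /=.
  under eq_big => [g | g Gg].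
    rewrite groupMr ?groupV //; over.
    rewrite rmorphM /= -galM // -mulgA mulVg mulg1 -galM //.
    have ->: (j ^ (g * s^-1) * s = s * (j ^ g))%g.
      by rewrite conjgM (conjgE _ s^-1%g) invgK -!mulgA mulVg mulg1.
    rewrite galM //; over.
  move=> trsE; rewrite /F; under eq_bigr do rewrite mulrC mulrBr !mulrA.
  by rewrite sumrB -!mulr_suml trE trsE -!scalerAl [s _ * _]mulrC subrr.
rewrite /F conjg1 => /eqP; rewrite subr_eq0 => /eqP eqF.
rewrite rmorphM fmorphV /= -galM // -(centsP abJ _ Js _ Jj) galM //.
by apply/eqP; rewrite eqr_div ?eqF.
Qed.

(** The candidate eigenvalue is a sum over J whose terms G permutes by conjugation; it is therefore
    G-invariant, hence in K. *)
Lemma ratio_equivariant_eigenvector (J : {group gal_of (normal_closure L)})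
      alpha :
    separable 1 L -> abelian J -> (J ><| galG' L)%g = galG L ->
    alpha \in L -> alpha != 0 ->
    (forall j g, j \in J -> g \in galG L ->
       (j ^ g)%g alpha / alpha = g (j alpha / alpha)) ->
  eigenvector L (acg_subgroup L J) alpha.
Proof.
move=> sepL abJ sdJ La nza ratioJ; split=> // h [[Eh _] invh].
have [/andP[sJG nJG] _ _ _ _] := sdprod_context sdJ.
have Ea := subvP (sub_normal_closure L) _ La.
pose c := \sum_(j in J) h (lambda j) * (j^-1%g alpha / alpha).
suffices /vlineP[k ck] : c \in 1%VS.
  exists k; rewrite hopf_actionE // -[alpha in RHS]mul1r scalerAl -ck.
  rewrite mulr_suml; apply: eq_bigr => j _.
  by rewrite -mulrA divfK.
have Ec: c \in normal_closure L.
  by rewrite rpred_sum // => j _; rewrite rpredM ?rpred_div ?memv_gal.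
rewrite -(galois_fixedField (normal_closure_galois sepL)).
apply/fixedFieldP=> // g Gg; rewrite rmorph_sum /=.
rewrite [RHS](reindex_inj (conjg_inj g)) /=; apply: eq_big => [j | j Jj].
  by rewrite memJ_norm // (subsetP nJG).
rewrite rmorphM -conjVg ratioJ ?groupV //; congr (_ * _).
rewrite -{2}(invh g Gg) ffunE (morphJ lambda_morphism) ?(subsetP sJG j) //=.
by rewrite conjgK.
Qed.

Lemma degree_sdprod (J : {group gal_of (normal_closure L)}) :
    separable 1 L -> (J ><| galG' L)%g = galG L -> #|J| = \dim L.
Proof.
move=> sepL /sdprod_card cardG; have galE := normal_closure_galois sepL.
have sLE := sub_normal_closure L.
have galLE : galois L (normal_closure L) by rewrite (galoisS _ galE) ?sub1v.
apply/eqP; rewrite -(eqn_pmul2r (cardG_gt0 (galG' L))) cardG.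
rewrite -(galois_dim galE) -(galois_dim galLE) dimv1 divn1 mulnC.
by rewrite divnK // field_dimS.
Qed.

End AlmostClassicalStructure.

(** * The polynomial X^n - alpha^n, its roots and the fields they generate *)

Section RadicalExtension.

Set Implicit Arguments.
Unset Strict Implicit.

Variables (n : nat) (K : fieldType) (Omega : splittingFieldType K).
Variables (zeta alpha : Omega).
Hypotheses (n_gt0 : (0 < n)%N) (zeta_prim : n.-primitive_root zeta).
Hypothesis alpha_neq0 : alpha != 0.

Definition radical_roots : seq Omega :=
  mkseq (fun i => alpha * zeta ^+ i) n.

Lemma radical_rootsP x : reflect (x ^+ n = alpha ^+ n) (x \in radical_roots).
Proof.
apply: (iffP mapP) => [[i _ ->]|xn].
  by rewrite exprMn exprAC (prim_expr_order zeta_prim) expr1n mulr1.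
have: (x / alpha) ^+ n = 1 by rewrite expr_div_n xn divff ?expf_neq0.
case/(prim_rootP zeta_prim) => i xi; exists (i : nat).
  by rewrite mem_iota /= ltn_ord.
by rewrite -xi mulrC divfK.
Qed.

Lemma uniq_radical_roots : uniq radical_roots.
Proof.
rewrite map_inj_in_uniq ?iota_uniq // => i j.
rewrite !mem_iota /= !add0n => ltin ltjn /(mulfI alpha_neq0) /eqP.
by rewrite (eq_prim_root_expr zeta_prim) !modn_small // => /eqP.
Qed.

Lemma prod_radical_roots :
  'X^n - (alpha ^+ n)%:P = \prod_(x <- radical_roots) ('X - x%:P).
Proof.
rewrite -[RHS]scale1r -[1](_ : lead_coef ('X^n - (alpha ^+ n)%:P) = 1).
  apply: all_roots_prod_XsubC.
  - by rewrite size_XnsubC // size_mkseq.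
  - apply/allP=> x /radical_rootsP xn.
    by rewrite /root !hornerE xn subrr.
  - by rewrite uniq_rootsE uniq_radical_roots.
exact: lead_coefXnsubC.
Qed.

(** Controls, up to sign, the constant coefficient of any monic factor of X^n - alpha^n; [u] is a
    power of [zeta]. *)
Lemma prod_sub_radical_roots (M : {subfield Omega}) s :
  zeta \in M -> {subset s <= radical_roots} ->
  exists2 u, u \in M & u != 0 /\ \prod_(x <- s) x = alpha ^+ size s * u.
Proof.
move=> Mz; elim: s => [|x s IHs] sS.
  by exists 1; rewrite ?rpred1 // oner_eq0 big_nil mulr1.
have [|u Mu [nzu eq_u]] := IHs; first by move=> y sy; rewrite sS // inE sy orbT.
have /mapP[i _ ->]: x \in radical_roots by rewrite sS ?mem_head.
exists (zeta ^+ i * u); first by rewrite rpredM ?rpredX.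
split; last by rewrite big_cons eq_u /= exprS mulrACA.
rewrite mulf_neq0 ?expf_neq0 //; apply/eqP=> z0.
have := prim_expr_order zeta_prim; rewrite z0 expr0n gtn_eqF //.
by move/esym/eqP; rewrite oner_eq0.
Qed.

Section Disjoint.

Variable M : {subfield Omega}.
Hypotheses (Mzeta : zeta \in M) (alphan : alpha ^+ n \in 1%VS).
Hypothesis alpha_min :
  forall m, (0 < m)%N -> alpha ^+ m \in M -> (n <= m)%N.

Lemma minPoly_radical : minPoly M alpha = 'X^n - (alpha ^+ n)%:P.
Proof.
have Mn : alpha ^+ n \in M by apply: (subvP (sub1v M)).
have : minPoly M alpha %| 'X^n - (alpha ^+ n)%:P.
  apply: minPoly_dvdp; first by rewrite polyOverXnsubC.
  by rewrite /root !hornerE subrr.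
rewrite prod_radical_roots => dvd_p; have [m] := dvdp_prod_XsubC dvd_p.
rewrite eqp_monic ?monic_minPoly ?monic_prod_XsubC //.
set s := mask _ _ => /eqP def_p.
have [|u Mu [nzu prod_s]] := @prod_sub_radical_roots M s Mzeta.
  by move=> x /mem_mask.
have sz_s : adjoin_degree M alpha = size s.
  by apply/eqP; rewrite -eqSS -size_minPoly def_p size_prod_XsubC.
(* The constant coefficient lies in M and is [alpha ^+ size s] times a nonzero element of M. *)
have Ms : alpha ^+ size s \in M.
  have : (minPoly M alpha)`_0 \in M by apply/polyOverP/minPolyOver.
  rewrite def_p coef0_prod_XsubC prod_s.
  by rewrite mulrA fpredMr // fpredMl ?signr_eq0 // rpredX ?rpredN ?rpred1.
have le_n : (n <= size s)%N.
  apply: alpha_min => //; rewrite -sz_s adjoin_degreeE.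
  by rewrite divn_gt0 ?dimvS ?subv_adjoin // adim_gt0.
apply/eqP; rewrite -eqp_monic ?monic_minPoly ?monic_prod_XsubC //.
rewrite -dvdp_size_eqp // size_minPoly sz_s size_prod_XsubC size_mkseq eqSS.
rewrite eqn_leq le_n andbT -ltnS -sz_s -size_minPoly.
have <- := size_mkseq (fun i => alpha * zeta ^+ i) n.
rewrite -(size_prod_XsubC _ id).
by rewrite dvdp_leq ?monic_neq0 ?monic_prod_XsubC.
Qed.

(** The minimal polynomial over K divides X^n - alpha^n and is a multiple of the one over M, which
    already has degree n. *)
Lemma dim_radical : \dim <<1; alpha>> = n.
Proof.
rewrite dim_Fadjoin dimv1 muln1; apply/eqP; rewrite eqn_leq; apply/andP; split.
  rewrite -ltnS -size_minPoly -(size_XnsubC (alpha ^+ n) n_gt0).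
  rewrite dvdp_leq ?monic_neq0 ?monicXnsubC // minPoly_dvdp ?polyOverXnsubC //.
  by rewrite /root !hornerE subrr.
rewrite -ltnS -(size_XnsubC (alpha ^+ n) n_gt0) -minPoly_radical -size_minPoly.
by rewrite dvdp_leq ?monic_neq0 ?monic_minPoly // minPolyS ?sub1v.
Qed.

(** [alpha * zeta] is a conjugate of [alpha] over K, so [zeta] is a quotient of two elements of
    E. *)
Lemma zeta_normal_closure (E : {subfield Omega}) :
  normalField 1 E -> alpha \in E -> zeta \in E.
Proof.
move=> /normalFieldP nE Ea; have [r Er def_p] := nE _ Ea.
have: root (minPoly 1 alpha) (alpha * zeta).
  apply: (root_dvdp (minPolyS alpha (sub1v M))).
  rewrite minPoly_radical /root !hornerE exprMn (prim_expr_order zeta_prim).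
  by rewrite mulr1 subrr.
by rewrite def_p root_prod_XsubC => /(allP Er); rewrite fpredMl.
Qed.

End Disjoint.

Lemma separable_radical :
  alpha ^+ n \in 1%VS -> separable 1 <<1; alpha>>.
Proof.
move=> Kan; rewrite -adjoin_separable_eq; apply/separable_elementP.
exists ('X^n - (alpha ^+ n)%:P); split; first by rewrite polyOverXnsubC.
  by rewrite /root !hornerE subrr.
by rewrite prod_radical_roots separable_prod_XsubC uniq_radical_roots.
Qed.

Lemma normalField1_stable (E : {subfield Omega}) :
  (forall f : 'AEnd(Omega), (f @: E <= E)%VS) -> normalField 1 E.
Proof.
move=> stE; apply/forall_inP=> f _.
by have := stE f; rewrite -kAut1E => /andP[].
Qed.

Lemma normal_cyclotomic : normalField 1 <<1; zeta>>%AS.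
Proof.
apply: normalField1_stable => f; rewrite aimg_adjoin aimg1.
apply/FadjoinP; split; first exact: sub1v.
have: (f zeta) ^+ n = 1 by rewrite -rmorphXn prim_expr_order ?rmorph1.
by case/(prim_rootP zeta_prim)=> i ->; rewrite rpredX ?memv_adjoin.
Qed.

(** Bounds the normal closure of K(alpha) from above. *)
Lemma normal_radical :
  alpha ^+ n \in 1%VS -> normalField 1 <<<<1; zeta>>; alpha>>%AS.
Proof.
move=> Kan; have nM := normal_cyclotomic.
apply: normalField1_stable => f; rewrite aimg_adjoin.
have /eqP-> : (f @: <<1; zeta>> == <<1; zeta>>)%VS.
  by apply: (forall_inP nM); rewrite inE kAutfE k1AHom.
apply/FadjoinP; split; first exact: subv_adjoin.
have /radical_rootsP/mapP[i _ ->] : (f alpha) ^+ n = alpha ^+ n.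
  by rewrite -rmorphXn; apply: (kAHomP (k1AHom {:Omega} f)).
by rewrite rpredM ?memv_adjoin // rpredX // subvP_adjoin ?memv_adjoin.
Qed.

End RadicalExtension.

(** * The two implications *)

Lemma eigenvector_radical (n : nat) (K : fieldType)
    (Omega : splittingFieldType K) (zeta alpha : Omega) (L M : {subfield Omega})
    (J : {group gal_of (normal_closure L)}) :
    n.-primitive_root zeta -> M = <<1; zeta>>%AS -> L = <<1; alpha>>%AS ->
    \dim L = n -> galois_complement L M J -> cyclic J ->
    eigenvector L (acg_subgroup L J) alpha ->
  [/\ (L :&: M)%VS = 1%VS, alpha ^+ n \in 1%VS
    & forall m : nat, (0 < m)%N -> alpha ^+ m \in 1%VS -> (n <= m)%N].
Proof.
move=> zeta_prim defM defL dimL [sepL sdJ fixJ] cycJ eig.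
have galE := normal_closure_galois sepL; have sLE := sub_normal_closure L.
have [/andP[sJG _] _ defG _ tiJ] := sdprod_context sdJ.
have [La nza _] := eig; have Ea := subvP sLE _ La.
(* An element of M is fixed by J and one of L by G', so an element of both is fixed by G = J G'. *)
have capLM : (L :&: M)%VS = 1%VS.
  apply/eqP; rewrite eqEsubv sub1v andbT.
  apply/subvP=> x /memv_capP[Lx]; rewrite -fixJ => /mem_fixedFieldP[Ex Jx].
  rewrite -(galois_fixedField galE); apply/fixedFieldP=> // g Gg.
  have: g \in (J * galG' L)%g by rewrite defG.
  case/mulsgP=> j t Jj G't ->.
  by rewrite galM // Jx // (fixed_gal sLE G't).
have ratio_fixed := eigenvector_ratio_fixed (cyclic_abelian cycJ) sdJ eig.
have [s defJ] := cyclicP cycJ; have Js : s \in J by rewrite defJ cycle_id.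
have ord_s : #[s]%g = n by rewrite -dimL -(degree_sdprod sepL sdJ) defJ.
have fixL (f : 'AEnd(Omega)) : f alpha = alpha -> {in L, forall x, f x = x}.
  move=> fa x Lx; suffices /subvP sLf : (L <= fixedSpace f)%VS.
    exact/fixedSpaceP/sLf.
  rewrite defL; apply/FadjoinP; split; first exact: sub1v.
  exact/fixedSpaceP.
pose u := s alpha / alpha.
have sk k : (s ^+ k)%g alpha = u ^+ k * alpha.
  elim: k => [|k IHk]; first by rewrite expg0 gal_id mul1r.
  rewrite expgSr galM // IHk rmorphM rmorphXn /= ratio_fixed // exprSr -mulrA.
  by rewrite divfK.
(* If [u ^+ k = 1], then [s ^+ k] fixes [alpha], hence L, and lies in the trivial intersection of J
   and G'. *)
have u_eq1 k : u ^+ k = 1 -> (n %| k)%N.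
  move=> uk; rewrite -ord_s order_dvdn -in_set1.
  rewrite -[[set 1%g]]tiJ inE groupX //= gal_kHom //; apply/kAHomP.
  by move=> x Lx; apply: fixL Lx; rewrite sk uk mul1r.
have un : u ^+ n = 1.
  apply: (mulIf nza); rewrite -sk mul1r -ord_s expg_order gal_id //.
split=> // [|m m_gt0 Kam].
  (* [s] multiplies [alpha ^+ n] by [u ^+ n = 1], so this power is fixed by J and lies in M as well
     as in L. *)
  rewrite -capLM memv_cap rpredX // -fixJ.
  apply/fixedFieldP; first by rewrite rpredX.
  move=> x; rewrite defJ => /cycleP[k ->].
  by rewrite rmorphXn /= sk exprMn exprAC un expr1n mul1r.
(* [s] fixes [alpha ^+ m], which is in K, and also multiplies it by [u ^+ m]. *)
apply: dvdn_leq => //; apply: u_eq1; apply: (mulIf (expf_neq0 m nza)).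
rewrite -exprMn mul1r -[u]expr1 -sk expg1 -rmorphXn /=.
by rewrite (fixed_gal (sub1v _) (subsetP sJG _ Js)).
Qed.

Lemma radical_eigenvector (n : nat) (K : fieldType)
    (Omega : splittingFieldType K) (zeta alpha : Omega)
    (L M : {subfield Omega}) :
    (0 < n)%N -> n.-primitive_root zeta -> alpha != 0 ->
    M = <<1; zeta>>%AS -> L = <<1; alpha>>%AS ->
    (L :&: M)%VS = 1%VS -> alpha ^+ n \in 1%VS ->
    (forall m : nat, (0 < m)%N -> alpha ^+ m \in 1%VS -> (n <= m)%N) ->
  \dim L = n /\
  exists J : {group gal_of (normal_closure L)},
    [/\ galois_complement L M J, cyclic J
      & eigenvector L (acg_subgroup L J) alpha].
Proof.
move=> n_gt0 zeta_prim nza defM defL capLM Kan alpha_min.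
have Mz : zeta \in M by rewrite defM memv_adjoin.
have La : alpha \in L by rewrite defL memv_adjoin.
(* A power of [alpha] in M lies in the intersection of L and M, which is K; minimality over K thus
   passes to M. *)
have alpha_minM m : (0 < m)%N -> alpha ^+ m \in M -> (n <= m)%N.
  by move=> m_gt0 Mam; apply: alpha_min; rewrite // -capLM memv_cap rpredX.
have minP := minPoly_radical n_gt0 zeta_prim nza Mz Kan alpha_minM.
have dimL : \dim L = n.
  by rewrite defL; exact: (dim_radical n_gt0 zeta_prim nza Mz Kan alpha_minM).
have sepL : separable 1 L by rewrite defL (separable_radical n_gt0 zeta_prim).
have galE := normal_closure_galois sepL; have sLE := sub_normal_closure L.
have Ea := subvP sLE _ La.
have Ez : zeta \in normal_closure L.
  have nE := normal_closure_normal L.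
  exact: (zeta_normal_closure n_gt0 zeta_prim nza Mz Kan alpha_minM nE Ea).
have sME : (M <= normal_closure L)%VS.
  by rewrite defM; apply/FadjoinP; rewrite sub1v.
have defE : (normal_closure L : {vspace Omega}) = <<M; alpha>>%VS.
  apply/eqP; rewrite eqEsubv; apply/andP; split; last exact/FadjoinP.
  apply: normal_closure_min; last first.
    by rewrite defM (normal_radical zeta_prim nza Kan).
  by rewrite defL; apply/FadjoinP; rewrite sub1v memv_adjoin.
have nM : normalField 1 M by rewrite defM; apply: normal_cyclotomic zeta_prim.
have galME : galois M (normal_closure L) by rewrite (galoisS _ galE) ?sub1v.
have galLE : galois L (normal_closure L) by rewrite (galoisS _ galE) ?sub1v.
pose J := 'Gal(normal_closure L / M)%G.
have ratioM (g : gal_of (normal_closure L)) : g \in galG L ->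
    exists2 w, w \in M & g alpha = w * alpha.
  move=> Gg; have : (g alpha) ^+ n = alpha ^+ n.
    by rewrite -rmorphXn /= (fixed_gal (sub1v _) Gg).
  case/(radical_rootsP zeta_prim nza)/mapP=> i _ ->.
  by exists (zeta ^+ i); rewrite ?rpredX // mulrC.
have sJG : J \subset galG L by apply: galS; apply: sub1v.
have fixM (j : gal_of (normal_closure L)) x : j \in J -> x \in M -> j x = x.
  by move=> Jj; apply: fixed_gal sME Jj.
have J_eq1 (j : gal_of (normal_closure L)) :
    j \in J -> j alpha = alpha -> j = 1%g.
  move=> Jj ja; apply/eqP/gal_eqP=> x Ex; rewrite gal_id.
  have {}Ex : x \in <<M; alpha>>%VS by rewrite -defE.
  suffices /subvP fixE : (<<M; alpha>> <= fixedSpace j)%VS.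
    exact/fixedSpaceP/fixE.
  apply/FadjoinP; split; last exact/fixedSpaceP.
  by apply/subvP=> y My; apply/fixedSpaceP/fixM.
have sdJ : (J ><| galG' L)%g = galG L.
  have /andP[_ nJG] : (J <| galG L)%g.
    by apply: normalField_normal; rewrite ?sub1v.
  have sG'G : galG' L \subset galG L by apply: galS; apply: sub1v.
  have tiJ : J :&: galG' L = 1%g.
    apply/trivgP/subsetP=> j /setIP[Jj G'j].
    by rewrite inE (J_eq1 j Jj) // (fixed_gal sLE G'j).
  rewrite sdprodE ?(subset_trans sG'G) //; apply/eqP.
  (* Orders decide: G has order n [M:K], J has order n and G' has order [M:K]. *)
  rewrite eqEcard mul_subG //= TI_cardMg // -(galois_dim galE).
  rewrite -(galois_dim galME) -(galois_dim galLE) dimv1 divn1 defE dim_Fadjoin.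
  rewrite mulnK ?adim_gt0 // dimL.
  have ->: adjoin_degree M alpha = n.
    by apply: succn_inj; rewrite -size_minPoly minP size_XnsubC.
  by rewrite mulKn.
have cycJ : cyclic J.
  pose f (j : gal_of (normal_closure L)) := j alpha / alpha.
  (* The ratio embeds J in the multiplicative group of a field; it is multiplicative because its
     values lie in M, which J fixes. *)
  apply: (@field_mul_group_cyclic _ J Omega f) ; rewrite /f.
    move=> x y Jx Jy; have [w Mw xa] := ratioM x (subsetP sJG _ Jx).
    by rewrite galM // xa rmorphM /= (fixM y) // mulfK // mulrA.
  move=> x Jx; split=> [xa | ->]; last by rewrite gal_id divff.
  by apply: J_eq1; rewrite // -[LHS](divfK nza) xa mul1r.
split=> //; exists J; split=> //.
  by split=> //; apply/galois_fixedField.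
apply: ratio_equivariant_eigenvector => //; first exact: cyclic_abelian.
(* [j ^ g] applies [g^-1] first, which multiplies [alpha] by some [w] in M. As [j] fixes [w], the
   factor [g w] appears in numerator and denominator and cancels. *)
move=> j g Jj Gg; have [w Mw ga] := ratioM (g^-1)%g (groupVr Gg).
have Eja : j alpha \in normal_closure L by rewrite memv_gal.
have alphaE : alpha = g w * g alpha.
  by rewrite -rmorphM -ga /= -galM // mulVg gal_id.
have nzgw : g w != 0.
  by apply: contraNneq nza => gw0; rewrite alphaE gw0 mul0r.
rewrite conjgE !galM ?memv_gal // ga rmorphM /= (fixM j) // !rmorphM fmorphV /=.
by rewrite [X in _ / X = _]alphaE -mulf_div divff ?mul1r.
Qed.

Theorem theorem6p2 (n : nat) (K : fieldType) (Omega : splittingFieldType K)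
    (zeta alpha : Omega) (L M : {subfield Omega})
    (n_gt0 : (0 < n)%N)
    (charKn : forall p : nat, p \in [pchar K] -> ~~ (p %| n)%N)
    (zeta_prim : n.-primitive_root zeta)
    (defM : M = <<1; zeta>>%AS)
    (defL : L = <<1; alpha>>%AS)
    (nondeg : (n = 1)%N -> alpha != 0) :
  [/\ (L :&: M)%VS = 1%VS,
      alpha ^+ n \in 1%VS
    & forall m : nat, (0 < m)%N -> alpha ^+ m \in 1%VS -> (n <= m)%N]
  <->
  (\dim L = n /\
   exists J : {group gal_of (normal_closure L)},
     [/\ galois_complement L M J,
         cyclic J
       & eigenvector L (acg_subgroup L J) alpha]).
Proof.
split=> [[capLM Kan alpha_min] | [dimL [J [compJ cycJ eig]]]]; last first.
  exact: eigenvector_radical zeta_prim defM defL dimL compJ cycJ eig.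
(* If [alpha] were 0, its first power would be in K and minimality would force n = 1, the case
   excluded by [nondeg]: there the radical conditions hold for 0, which is no eigenvector. *)
have nza : alpha != 0.
  apply: contraPneq nondeg => alpha0; rewrite alpha0 eqxx => /(_ _)/negP[] //.
  by apply/eqP; rewrite eqn_leq n_gt0 alpha_min // alpha0 expr1 rpred0.
exact: radical_eigenvector n_gt0 zeta_prim nza defM defL capLM Kan alpha_min.
Qed.
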